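(* Let Assumption (A1) hold and let $\boldsymbol\alpha,\boldsymbol\alpha'\in\mathcal K_H^{\boldsymbol\alpha}$. Then $(\boldsymbol K_1^{\boldsymbol\alpha},\boldsymbol K_2^{\boldsymbol\alpha},\hat{\boldsymbol P}^{\boldsymbol\alpha})=(\boldsymbol K_1^{\boldsymbol\alpha'},\boldsymbol K_2^{\boldsymbol\alpha'},\hat{\boldsymbol P}^{\boldsymbol\alpha'})$ if and only if $\boldsymbol\alpha=\boldsymbol\alpha'$.
   Context: $n,p_1,p_2$ are positive integers, $p_1,p_2\le n$, $H_1\in\mathbb R^{p_1\times n}$, $H_2\in\mathbb R^{p_2\times n}$, $H=\begin{pmatrix}H_1\\H_2\end{pmatrix}$. Assumption (A1): $\mathrm{rk}(H_1)=p_1$, $\mathrm{rk}(H_2)=p_2$, $\mathrm{rk}(H)=n$ (and the two input estimators $\hat x_1,\hat x_2$ are unbiased estimators of $H_1x_{\rm true}$, $H_2x_{\rm true}$; in the deterministic maps below only their values enter). $\mathcal P_m^\succ$: real symmetric positive definite $m\times m$ matrices; $\preceq,\prec$ refer to the Löwner order. $\mathcal D_F:=\mathbb R^{p_1}\times\mathbb R^{p_2}\times\mathcal P_{p_1}^\succ\times\mathcal P_{p_2}^\succ$, with points denoted $(\hat x_1,\hat x_2,\hat P_1,\hat P_2)$. Statements about maps on $\mathcal D_F$ are read pointwise. $\mathcal K_H^{\boldsymbol\alpha}$ denotes the set of all functions $\boldsymbol\alpha\colon\mathcal D_F\to[0,1]$ such that, at each point of $\mathcal D_F$: $\boldsymbol\alpha=0$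 if $H_2^\top\hat P_2^{-1}H_2\succ H_1^\top\hat P_1^{-1}H_1$; $\boldsymbol\alpha\in[0,1]$ is arbitrary if $H_2^\top\hat P_2^{-1}H_2=H_1^\top\hat P_1^{-1}H_1$; $\boldsymbol\alpha=1$ if $H_2^\top\hat P_2^{-1}H_2\prec H_1^\top\hat P_1^{-1}H_1$; and otherwise $\boldsymbol\alpha\in[0,1]$ is such that $\boldsymbol\alpha H_1^\top\hat P_1^{-1}H_1+(1-\boldsymbol\alpha)H_2^\top\hat P_2^{-1}H_2$ is non-singular. For $\boldsymbol\alpha\in\mathcal K_H^{\boldsymbol\alpha}$ define maps on $\mathcal D_F$ by $\hat{\boldsymbol P}^{\boldsymbol\alpha}:=(\boldsymbol\alpha H_1^\top\hat P_1^{-1}H_1+(1-\boldsymbol\alpha)H_2^\top\hat P_2^{-1}H_2)^{-1}$, $\boldsymbol K_1^{\boldsymbol\alpha}:=\boldsymbol\alpha\hat{\boldsymbol P}^{\boldsymbol\alpha}H_1^\top\hat P_1^{-1}$, $\boldsymbol K_2^{\boldsymbol\alpha}:=(1-\boldsymbol\alpha)\hat{\boldsymbol P}^{\boldsymbol\alpha}H_2^\top\hat P_2^{-1}$. *)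

(* Defs.v *)
From mathcomp Require Import all_boot all_order all_algebra.
From mathcomp Require Import boolp classical_sets reals.

Set Implicit Arguments.
Unset Strict Implicit.
Unset Printing Implicit Defensive.

Import Order.TTheory GRing.Theory Num.Theory.

Local Open Scope classical_set_scope.
Local Open Scope ring_scope.

Definition posdefmx (R : realType) (m : nat) : set 'M[R]_m :=
  [set M | M^T = M /\ forall x : 'cV[R]_m, x != 0 -> 0 < (x^T *m M *m x) 0 0].

(* Strict Loewner order: A ≺ B. *)
Definition loewner_lt (R : realType) (m : nat) (A B : 'M[R]_m) : Prop :=
  posdefmx (B - A).

(* Points (x1, x2, P1, P2) of the domain D_F; the coercion of sets to types
   makes the covariance components elements of the positive definite cone. *)
Record domF (R : realType) (p1 p2 : nat) := DomF {
  xhat1 : 'cV[R]_p1;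
  xhat2 : 'cV[R]_p2;
  Phat1 : @posdefmx R p1;
  Phat2 : @posdefmx R p2
}.

Definition full_rank_assumption (R : realType) (n p1 p2 : nat)
    (H1 : 'M[R]_(p1, n)) (H2 : 'M[R]_(p2, n)) : Prop :=
  [/\ \rank H1 = p1, \rank H2 = p2 & \rank (col_mx H1 H2) = n].

Section Fusion.
Variables (R : realType) (n p1 p2 : nat).
Variables (H1 : 'M[R]_(p1, n)) (H2 : 'M[R]_(p2, n)).
Implicit Types (alpha : domF R p1 p2 -> R) (d : domF R p1 p2).

Definition info1 d : 'M[R]_n := H1^T *m invmx (val (Phat1 d)) *m H1.

Definition info2 d : 'M[R]_n := H2^T *m invmx (val (Phat2 d)) *m H2.

Definition info_comb alpha d : 'M[R]_n :=
  alpha d *: info1 d + (1 - alpha d) *: info2 d.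

Definition alpha_set : set (domF R p1 p2 -> R) :=
  [set alpha | forall d,
    [/\ 0 <= alpha d <= 1,
        loewner_lt (info1 d) (info2 d) -> alpha d = 0,
        loewner_lt (info2 d) (info1 d) -> alpha d = 1
      & ~ loewner_lt (info1 d) (info2 d) ->
        info2 d <> info1 d ->
        ~ loewner_lt (info2 d) (info1 d) ->
        info_comb alpha d \in unitmx]].

Definition Phat alpha d : 'M[R]_n := invmx (info_comb alpha d).

Definition gain1 alpha d : 'M[R]_(n, p1) :=
  alpha d *: (Phat alpha d *m H1^T *m invmx (val (Phat1 d))).

Definition gain2 alpha d : 'M[R]_(n, p2) :=
  (1 - alpha d) *: (Phat alpha d *m H2^T *m invmx (val (Phat2 d))).

End Fusion.

(* Main.v *)
Require Import Defs.
From mathcomp Require Import all_boot all_order all_algebra.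
From mathcomp Require Import boolp classical_sets reals.

(** Equal weights trivially give equal maps.  For the converse, fix a point of
    the domain.  If one information matrix strictly dominates the other, every
    admissible weight takes the same prescribed value there.  Otherwise the
    combined information matrix is nonsingular ([info_comb_unitmx]): this is
    imposed on admissible weights, except when both sources carry the same
    information.  In that case the combination is the common matrix, whose
    kernel lies in the kernels of both H1 and H2 ([info_ker]) and is therefore
    trivial, because the stacked matrix has full column rank ([info1_unitmx]).

    So the fused covariance is invertible, as is the covariance of the first
    source.  If two weights give the same fused covariance and the same first
    gain, both invertible factors cancel from the gain, leaving equal multiples
    of the transpose of H1.  That matrix is nonzero because H1 has positive
    rank, so the two weights agree ([gain1_Phat_inj]). *)

Set Implicit Arguments.
Unset Strict Implicit.
Unset Printing Implicit Defensive.

Import Order.TTheory GRing.Theory Num.Theory.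

Local Open Scope classical_set_scope.
Local Open Scope ring_scope.

Section Nonsingularity.
Variable R : realType.

Lemma unitmx_cV_inj (m : nat) (A : 'M[R]_m) :
  (forall x : 'cV[R]_m, A *m x = 0 -> x = 0) -> A \in unitmx.
Proof.
move=> injA; rewrite -unitmx_tr -row_free_unit; apply: inj_row_free => v vA0.
apply: trmx_inj; rewrite trmx0; apply: injA.
by rewrite -[A]trmxK -trmx_mul vA0 trmx0.
Qed.

Lemma posdefmx_ker (m : nat) (P : 'M[R]_m) (z : 'cV[R]_m) :
  posdefmx P -> (z^T *m P *m z) 0 0 = 0 -> z = 0.
Proof.
move=> [_ Ppos] zPz0; apply/eqP; apply: contraT => /Ppos.
by rewrite zPz0 ltxx.
Qed.

Lemma posdefmx_unitmx (m : nat) (P : 'M[R]_m) : posdefmx P -> P \in unitmx.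
Proof.
move=> Ppd; apply: unitmx_cV_inj => x Px0.
by apply: (posdefmx_ker Ppd); rewrite -mulmxA Px0 mulmx0 mxE.
Qed.

(** With z the image of H x under the inverse of P, the quadratic form of the
    information matrix at x is that of P at z, so its vanishing forces z = 0. *)
Lemma info_ker (m n : nat) (P : 'M[R]_m) (H : 'M[R]_(m, n)) (x : 'cV[R]_n) :
  posdefmx P -> H^T *m invmx P *m H *m x = 0 -> H *m x = 0.
Proof.
move=> Ppd infox0; have Pu := posdefmx_unitmx Ppd; have [Psym _] := Ppd.
suff z0 : invmx P *m (H *m x) = 0 by rewrite -[H *m x](mulKVmx Pu) z0 mulmx0.
apply: (posdefmx_ker Ppd).
rewrite -mulmxA mulKVmx // !trmx_mul trmx_inv Psym.
by rewrite -!mulmxA [X in x^T *m X](_ : _ = 0) ?mulmx0 ?mxE // -infox0 !mulmxA.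
Qed.

End Nonsingularity.

Section Identifiability.
Variables (R : realType) (n p1 p2 : nat).
Variables (H1 : 'M[R]_(p1, n)) (H2 : 'M[R]_(p2, n)).

Lemma Phat1_posdefmx (d : domF R p1 p2) : posdefmx (val (Phat1 d)).
Proof. exact: set_mem (valP (Phat1 d)). Qed.

Lemma Phat2_posdefmx (d : domF R p1 p2) : posdefmx (val (Phat2 d)).
Proof. exact: set_mem (valP (Phat2 d)). Qed.

(** A vector killed by the common information matrix is killed by both H1 and
    H2, hence by the stacked matrix. *)
Lemma info1_unitmx (d : domF R p1 p2) :
  \rank (col_mx H1 H2) = n ->
  info2 H2 d = info1 H1 d -> info1 H1 d \in unitmx.
Proof.
move=> rkH eq21; apply: unitmx_cV_inj => x info1x0.
have H1x0 := info_ker (Phat1_posdefmx d) info1x0.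
have H2x0 : H2 *m x = 0.
  by apply: (info_ker (Phat2_posdefmx d)); rewrite -/(info2 H2 d) eq21.
have Hfree : row_free (col_mx H1 H2)^T by rewrite /row_free mxrank_tr rkH.
apply: trmx_inj; apply: (row_free_inj Hfree).
by rewrite -trmx_mul mul_col_mx H1x0 H2x0 col_mx0 !trmx0 mul0mx.
Qed.

Lemma info_comb_unitmx (alpha : domF R p1 p2 -> R) (d : domF R p1 p2) :
  \rank (col_mx H1 H2) = n -> alpha_set H1 H2 alpha ->
  ~ loewner_lt (info1 H1 d) (info2 H2 d) ->
  ~ loewner_lt (info2 H2 d) (info1 H1 d) ->
  info_comb H1 H2 alpha d \in unitmx.
Proof.
move=> rkH /(_ d) [_ _ _ comb_unit] nlt12 nlt21.
have [eq21|neq21] := pselect (info2 H2 d = info1 H1 d); last exact: comb_unit.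
rewrite /info_comb eq21 -scalerDl addrC subrK scale1r; exact: info1_unitmx.
Qed.

(** The fused covariance and the inverse of the first covariance are invertible
    factors of the gain; cancelling them leaves the weight times the transpose
    of H1. *)
Lemma gain1_Phat_inj (alpha alpha' : domF R p1 p2 -> R) (d : domF R p1 p2) :
  H1 != 0 -> info_comb H1 H2 alpha d \in unitmx ->
  gain1 H1 H2 alpha d = gain1 H1 H2 alpha' d ->
  Phat H1 H2 alpha d = Phat H1 H2 alpha' d ->
  alpha d = alpha' d.
Proof.
move=> H1_neq0 comb_unit; rewrite /gain1 => + eqPhat; rewrite -eqPhat.
have P1u := posdefmx_unitmx (Phat1_posdefmx d).
move=> /(congr1 (fun K => info_comb H1 H2 alpha d *m (K *m val (Phat1 d)))).
rewrite -!scalemxAl !mulmxKV // -!scalemxAr !mulKVmx // => /eqP.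
rewrite -subr_eq0 -scalerBl scaler_eq0 subr_eq0 => /orP[/eqP //|].
by rewrite trmx_eq0 (negPf H1_neq0).
Qed.

End Identifiability.

Theorem theorem19 (R : realType) (n p1 p2 : nat)
    (n_gt0 : (0 < n)%N) (p1_gt0 : (0 < p1)%N) (p2_gt0 : (0 < p2)%N)
    (p1_le_n : (p1 <= n)%N) (p2_le_n : (p2 <= n)%N)
    (H1 : 'M[R]_(p1, n)) (H2 : 'M[R]_(p2, n))
    (HA1 : full_rank_assumption H1 H2)
    (alpha alpha' : domF R p1 p2 -> R)
    (Halpha : alpha_set H1 H2 alpha) (Halpha' : alpha_set H1 H2 alpha') :
  forall d : domF R p1 p2,
    (gain1 H1 H2 alpha d, gain2 H1 H2 alpha d, Phat H1 H2 alpha d) =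
    (gain1 H1 H2 alpha' d, gain2 H1 H2 alpha' d, Phat H1 H2 alpha' d)
    <-> alpha d = alpha' d.
Proof.
move=> d; split=> [[eq1 _ eqPhat]|eqa]; last first.
  by rewrite /gain1 /gain2 /Phat /info_comb eqa.
have [_ a0 a1 _] := Halpha d; have [_ a'0 a'1 _] := Halpha' d.
have [lt12|nlt12] := pselect (loewner_lt (info1 H1 d) (info2 H2 d)).
  by rewrite a0 ?a'0.
have [lt21|nlt21] := pselect (loewner_lt (info2 H2 d) (info1 H1 d)).
  by rewrite a1 ?a'1.
have [rkH1 _ rkH] := HA1.
have H1_neq0 : H1 != 0 by rewrite -mxrank_eq0 rkH1 -lt0n.
exact: gain1_Phat_inj (info_comb_unitmx rkH Halpha nlt12 nlt21) eq1 eqPhat.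
Qed.
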